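(* Let $S$ be a semigroup generated by its squares and let $\lambda_{2}\in\mathbb{C}\setminus\{0\}$ be a given constant. The solutions $f,g_{1},h,g_{2}:S\to\mathbb{C}$ of the system $$f(xy)=f(x)g_{1}(y)+g_{1}(x)f(y),\qquad x,y\in S,$$ $$h(xy)=h(x)g_{2}(y)+g_{2}(x)h(y)+\lambda_{2}^{2}\,f(x)f(y),\qquad x,y\in S,$$ such that $f$ and $h$ are linearly independent are of the following forms, where $m,\mu,\chi_{1},\chi_{2},\chi_{3}\in\mathcal{M}(S)$ are such that $m\neq0$, $m\neq\mu$ and $\chi_{1},\chi_{2},\chi_{3}$ are different, $A,A_{1}\in\mathcal{A}(S\setminus I_{m})$ are such that $A\neq0$, and $\alpha,\beta,\lambda,c,d\in\mathbb{C}\setminus\{0\}$ are constants: (1) $f=\Psi_{m}(A)$, $g_{1}=m$, $h=\frac{1}{2}\Psi_{m}(A_{1}+\lambda_{2}^{2}A^{2})$, $g_{2}=m$. (2) $f=\alpha(\mu-m)$, $g_{1}=\frac{\mu+m}{2}$, $h=\alpha^{2}\lambda_{2}^{2}(\mu-m)-\alpha\lambda_{2}\Psi_{m}(A)$, $g_{2}=m$. (3) $f=\frac{1}{\lambda_{2}}\Psi_{m}(A)$, $g_{1}=m$, $h=c^{2}(\mu-m)-c\,\Psi_{m}(A)$, $g_{2}=\frac{\mu-m}{2}-\frac{1}{2c}\Psi_{m}(A)$. (4) $f=-\frac{1}{d\lambda_{2}}(\mu-m)$, $g_{1}=\frac{\mu+m}{2}$, $h=c(\mu-m)+\frac{1}{d}\Psi_{m}(A)$,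 $g_{2}=m$. (5) $f=\frac{1}{\lambda_{2}}\Psi_{m}(A)$, $g_{1}=m$, $h=c(\mu-m)+\frac{1}{d}\Psi_{m}(A)$, $g_{2}=\frac{\mu+m}{2}-\frac{1}{2}d\,\Psi_{m}(A)$, with $1-cd^{2}=0$. (6) $f=\frac{\chi_{1}-\chi_{2}}{2\lambda\lambda_{2}}$, $g_{1}=\frac{\chi_{1}+\chi_{2}}{2}$, $h=c\beta\chi_{1}+c(2-\beta)\chi_{2}-2c\chi_{3}$, $g_{2}=\frac{\beta\chi_{1}+(2-\beta)\chi_{2}+2\chi_{3}}{4}$, with $2c\lambda^{2}\beta(2-\beta)=1$. (7) $f=\frac{1}{\lambda\lambda_{2}(2-\beta)}(\chi_{1}-\chi_{3})$, $g_{1}=\frac{\chi_{1}+\chi_{3}}{2}$, $h=c\beta\chi_{1}+c(2-\beta)\chi_{2}-2c\chi_{3}$, $g_{2}=\frac{-\beta\chi_{1}+(2-\beta)\chi_{2}+2\chi_{3}}{2(2-\beta)}$, with $2c\lambda^{2}\beta(2-\beta)=1$. (8) $f=-\frac{1}{\lambda\lambda_{2}\beta}(\chi_{2}-\chi_{3})$, $g_{1}=\frac{\chi_{2}+\chi_{3}}{2}$, $h=c\beta\chi_{1}+c(2-\beta)\chi_{2}-2c\chi_{3}$, $g_{2}=\frac{\beta\chi_{1}-(2-\beta)\chi_{2}+2\chi_{3}}{2\beta}$, with $2c\lambda^{2}\beta(2-\beta)=1$.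
   Context: A semigroup is a set with an associative composition. $S$ is generated by its squares if for each $x\in S$ there exist $x_{1},\ldots,x_{n}\in S$ such that $x=x_{1}^{2}\cdots x_{n}^{2}$. For a semigroup $T$, $\mathcal{A}(T)$ is the set of additive functions on $T$, i.e. maps $a:T\to\mathbb{C}$ with $a(xy)=a(x)+a(y)$ for all $x,y\in T$; $\mathcal{M}(T)$ is the set of multiplicative functions on $T$, i.e. maps $\chi:T\to\mathbb{C}$ with $\chi(xy)=\chi(x)\chi(y)$ for all $x,y\in T$ (the zero function is allowed). A function is called non-zero ($\neq0$) if it is not identically zero. For $\chi\in\mathcal{M}(S)$, $\chi\neq0$, put $I_{\chi}:=\{x\in S\mid\chi(x)=0\}$; then $S\setminus I_{\chi}$ is a subsemigroup of $S$. For $\varphi:S\setminus I_{\chi}\to\mathbb{C}$ the function $\Psi_{\chi}(\varphi):S\to\mathbb{C}$ is defined by $\Psi_{\chi}(\varphi)(x)=\chi(x)\varphi(x)$ if $x\in S\setminus I_{\chi}$ and $\Psi_{\chi}(\varphi)(x)=0$ if $x\in I_{\chi}$. $A^{2}$ denotes the pointwise square of $A$. *)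

(* Defs.v *)
From HB Require Import structures.
From mathcomp Require Import all_boot all_order all_algebra.
From mathcomp Require Import reals.
From mathcomp Require Export complex.
Set Implicit Arguments.
Unset Strict Implicit.
Unset Printing Implicit Defensive.
Import GRing.Theory.
Local Open Scope ring_scope.
Local Open Scope complex_scope.

(* A semigroup has no unit, so the nonempty product x1^2 ... xn^2 is folded   *)
(* from its first factor.                                                     *)
Definition generated_by_squares (S : semigroupType) : Prop :=
  forall x : S, exists (x1 : S) (s : seq S),
    x = foldl (fun p y => (p * (y * y))%g) (x1 * x1)%g s.

Record additive_fun (R : realType) (T : semigroupType) := AdditiveFun {
  additive_fun_val :> T -> R[i];
  additive_funM : forall x y : T,
    additive_fun_val (x * y)%g = additive_fun_val x + additive_fun_val y }.

Record multiplicative_fun (R : realType) (T : semigroupType) :=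
  MultiplicativeFun {
    multiplicative_fun_val :> T -> R[i];
    multiplicative_funM : forall x y : T,
      multiplicative_fun_val (x * y)%g =
      multiplicative_fun_val x * multiplicative_fun_val y }.

Section NullComplement.
Variables (R : realType) (S : semigroupType) (chi : multiplicative_fun R S).

Definition null_ideal : pred S := [pred x | chi x == 0].

(* The subset S \ I_chi; it is empty when chi = 0. *)
Record null_complement := NullComplement {
  null_complement_val :> S;
  null_complementP : null_complement_val \notin null_ideal }.

HB.instance Definition _ := [isSub for null_complement_val].
HB.instance Definition _ := [Choice of null_complement by <:].

Fact null_complement_closed : mulg_closed [pred x | x \notin null_ideal].
Proof.
move=> x y; rewrite !inE => cx cy.
by rewrite multiplicative_funM mulf_neq0.
Qed.

HB.instance Definition _ :=
  SubChoice_isSubSemigroup.Build S _ null_complement null_complement_closed.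

(* insub x is Some u with val u = x when chi x != 0, and None when chi x = 0. *)
Definition Psi (phi : null_complement -> R[i]) (x : S) : R[i] :=
  if (insub x : option null_complement) is Some u then chi x * phi u else 0.

End NullComplement.

Definition linearly_independent2 (R : realType) (T : Type) (f h : T -> R[i]) :
    Prop :=
  forall a b : R[i], (forall x : T, a * f x + b * h x = 0) -> a = 0 /\ b = 0.

(* Main.v *)
(* Computing h((xy)z) = h(x(yz)) and f((xy)z) = f(x(yz)) shows that there are
   constants k and n with g2 = g1 + k h + n f, such that mu = g2 + k h is
   multiplicative and g1(xy) = g1(x) g1(y) + b f(x) f(y), where
   b = n^2 - 2 k lambda2^2.  Hence g1 + s f and g1 - s f are multiplicative
   whenever s^2 = b.  This gives form (1) for k = n = 0, (2) for k = 0 <> n,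
   (5) for k <> 0 = b and (6) for k <> 0 <> b; the other four forms yield no
   further solutions.
   If F(xy) = F(x) m(y) + m(x) F(y), then F vanishes on I_m, because F(x^2)
   does when m(x) = 0 and S is generated by squares; so F = Psi_m(F / m). *)
Require Import Defs.
From mathcomp Require Import all_boot all_order all_algebra.
From mathcomp Require Import reals.
From mathcomp Require Import boolp ring.
Import GRing.Theory.
Local Open Scope ring_scope.
Local Open Scope complex_scope.

(** * Consequences of associativity for the two functional equations, over any field *)

Section Associativity.
Set Implicit Arguments.
Unset Strict Implicit.
Variables (F : fieldType) (S : semigroupType).

(** Associativity of [f] gives [f z * E x y = f x * E y z], where [E] is the defect of
    multiplicativity of [g]. Using this twice, with the last argument [z0], moves both variables of
    [E] into [f]. *)
Lemma sine_law_cosine (f g : S -> F) (z0 : S) :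
    (forall x y, f (x * y)%g = f x * g y + g x * f y) -> f z0 != 0 ->
  exists b, forall x y, g (x * y)%g = g x * g y + b * (f x * f y).
Proof.
move=> hf fz0; pose E x y := g (x * y)%g - g x * g y.
have EP x y z : f z * E x y - f x * E y z = 0.
  have := congr1 f (mulgA x y z); rewrite /E !hf => /eqP.
  by rewrite -subr_eq0 => /eqP h0; rewrite -[RHS]oppr0 -[in RHS]h0; ring.
exists (E z0 z0 / (f z0 * f z0)) => x y.
apply/eqP; rewrite -subr_eq0; apply/eqP.
transitivity ((f z0 * E x y - f x * E y z0) / f z0
    + (f z0 * E y z0 - f y * E z0 z0) * f x / (f z0 * f z0)).
  by rewrite /E; field.
by rewrite !EP !mul0r addr0.
Qed.

Variables (l : F) (f g1 h g2 : S -> F).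
Hypothesis hf : forall x y, f (x * y)%g = f x * g1 y + g1 x * f y.
Hypothesis hh : forall x y,
  h (x * y)%g = h x * g2 y + g2 x * h y + l * (f x * f y).

(* Contracting the last variable of [DP] with the functional
   u |-> (f z1 * u z2 - f z2 * u z1) / det, which kills f and maps h to 1,
   gives D x y = h x * a y - k * l * (f x * f y); substituting this back and
   contracting again determines a, and leaves a proportionality between f and
   g2 - g1 - k * h. *)
Lemma structure_constants (z1 z2 : S) : l != 0 ->
    f z1 != 0 -> f z1 * h z2 - f z2 * h z1 != 0 ->
  exists k n, [/\ forall x, g2 x = g1 x + k * h x + n * f x,
    forall x y, g1 (x * y)%g =
      g1 x * g1 y + (n ^+ 2 - 2%:R * k * l) * (f x * f y)
    & forall x y, g2 (x * y)%g + k * h (x * y)%g =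
      (g2 x + k * h x) * (g2 y + k * h y)].
Proof.
move=> l0 fz1 d0; have [b g1M] := sine_law_cosine hf fz1.
pose D x y := g2 (x * y)%g - g2 x * g2 y; pose q x := g2 x - g1 x.
have DP x y z :
  h z * D x y - h x * D y z + l * (f y * (f x * q z - q x * f z)) = 0.
  have := congr1 h (mulgA x y z); rewrite /D /q !hh !hf => /eqP.
  by rewrite -subr_eq0 => /eqP e0; rewrite -[RHS]oppr0 -[in RHS]e0; ring.
pose det := f z1 * h z2 - f z2 * h z1.
pose k := (f z1 * q z2 - f z2 * q z1) / det.
pose a y := (f z1 * D y z2 - f z2 * D y z1) / det.
have DE x y : D x y = h x * a y - k * l * (f x * f y).
  apply/eqP; rewrite -subr_eq0; apply/eqP.
  transitivity ((f z1 *
    (h z2 * D x y - h x * D y z2 + l * (f y * (f x * q z2 - q x * f z2)))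
    - f z2 *
    (h z1 * D x y - h x * D y z1 + l * (f y * (f x * q z1 - q x * f z1))))
    / det).
    by rewrite /a /k /det; field.
  by rewrite !DP !mulr0 subrr mul0r.
pose a0 := (f z1 * a z2 - f z2 * a z1) / det.
have aE y : a y = a0 * h y.
  rewrite {1}/a !DE /a0 /det; field; exact: d0.
have qE x z : f x * (q z - k * h z) = f z * (q x - k * h x).
  apply: (mulIf (mulf_neq0 l0 fz1)); apply/eqP; rewrite -subr_eq0.
  by apply/eqP; rewrite -[RHS](DP x z1 z) !DE !aE; ring.
pose n := (q z1 - k * h z1) / f z1.
have g2E x : g2 x = g1 x + k * h x + n * f x.
  have : q x - k * h x = n * f x.
    by apply: (mulfI fz1); rewrite -(qE x z1) /n; field.
  by rewrite /q => /(canRL (subrK _)) /(canRL (subrK _)) ->; ring.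
(* The defect [D] is computed a second time, by expanding [g2 (x * y)] through [g2E]. Comparison
   with [DE] leaves only these two terms; contracting them with the functional that kills [f] makes
   the first coefficient vanish, and then [f z1 != 0] the second. *)
have eqb x y : (a0 - k ^+ 2) * (h x * h y)
    + (n ^+ 2 - 2%:R * k * l - b) * (f x * f y) = 0.
  have := DE x y; rewrite /D g2E aE hh hf g1M !g2E => /eqP.
  by rewrite -subr_eq0 => /eqP e0; rewrite -[RHS]oppr0 -[in RHS]e0; ring.
have a0h y : (a0 - k ^+ 2) * h y = 0.
  apply: (mulIf d0); rewrite mul0r.
  transitivity (f z1 * ((a0 - k ^+ 2) * (h z2 * h y)
      + (n ^+ 2 - 2%:R * k * l - b) * (f z2 * f y))
    - f z2 * ((a0 - k ^+ 2) * (h z1 * h y)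
      + (n ^+ 2 - 2%:R * k * l - b) * (f z1 * f y))); first by ring.
  by rewrite !eqb !mulr0 subrr.
have a0E : a0 = k ^+ 2.
  apply/eqP; rewrite -subr_eq0; apply/eqP/(mulIf d0); rewrite mul0r.
  transitivity (f z1 * ((a0 - k ^+ 2) * h z2) - f z2 * ((a0 - k ^+ 2) * h z1)).
    by ring.
  by rewrite !a0h !mulr0 subrr.
have bE : b = n ^+ 2 - 2%:R * k * l.
  apply/esym/eqP; rewrite -subr_eq0; apply/eqP/(mulIf (mulf_neq0 fz1 fz1)).
  by rewrite mul0r -[RHS](eqb z1 z1) a0E; ring.
exists k, n; split=> // [x y|x y]; first by rewrite g1M bE.
have -> : g2 (x * y)%g = D x y + g2 x * g2 y by rewrite /D subrK.
by rewrite DE aE a0E hh; ring.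
Qed.
End Associativity.

(** * Solutions of the sine law with a multiplicative function, expressed through [Psi] *)

Section Psi.
Set Implicit Arguments.
Unset Strict Implicit.
Variables (R : realType) (S : semigroupType) (m : multiplicative_fun R S).

Lemma Psi_null (phi : null_complement m -> R[i]) x : m x = 0 -> Psi phi x = 0.
Proof.
rewrite /Psi => mx; case: insubP => // u.
by rewrite /null_ideal inE mx eqxx.
Qed.

Lemma Psi_val (phi : null_complement m -> R[i]) (u : null_complement m) :
  Psi phi u = m u * phi u.
Proof. by rewrite /Psi; have := valK u; rewrite /= => ->. Qed.

Lemma null_complement_neq0 (u : null_complement m) : m u != 0.
Proof. by have := null_complementP u; rewrite inE. Qed.

Lemma eq_Psi (F : S -> R[i]) (phi : null_complement m -> R[i]) :
    (forall x, m x = 0 -> F x = 0) ->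
    (forall u : null_complement m, F u = m u * phi u) ->
  F =1 Psi phi.
Proof.
move=> F0 Fphi x; have [mx|mx] := eqVneq (m x) 0; first by rewrite F0 ?Psi_null.
have mx' : x \notin null_ideal m by rewrite inE.
by rewrite (Psi_val _ (NullComplement mx')) -Fphi.
Qed.

(** The representations below allow [m = 0]; that [m] and the additive function are non-zero is
    recovered here from the function represented. *)
Lemma Psi_neq0 (phi : null_complement m -> R[i]) :
    ~ (Psi phi =1 fun=> 0) -> ~ (m =1 fun=> 0) /\ ~ (phi =1 fun=> 0).
Proof.
move=> Psi0; split=> [m0|phi0]; apply: Psi0 => x; first exact/Psi_null/m0.
by rewrite /Psi; case: insubP => // u _ _; rewrite phi0 mulr0.
Qed.

Hypothesis hS : generated_by_squares S.

(** The law is required only when a factor lies in the null ideal, so that the quadratic equation is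
    covered too: its extra term vanishes there. *)
Lemma sine_law_null (F : S -> R[i]) :
    (forall x y, m x = 0 \/ m y = 0 -> F (x * y)%g = F x * m y + m x * F y) ->
  forall x, m x = 0 -> F x = 0.
Proof.
move=> hF; have Fsq y : m y = 0 -> F (y * y)%g = 0.
  by move=> my; rewrite hF ?my ?mul0r ?mulr0 ?addr0; last by left.
have msq y : m (y * y)%g = 0 -> m y = 0.
  by rewrite multiplicative_funM => /eqP; rewrite mulf_eq0 orbb => /eqP.
(* Induction on the number of squares: if [m] kills the product, it kills the initial product [p],
   where [IH] applies, or the last factor [y], where [Fsq] applies. *)
move=> x; have [x1 [s ->]] := hS x; elim/last_ind: s => [/msq/Fsq //|s y IH].
rewrite -cats1 foldl_cat /=; set p := foldl _ _ s in IH *.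
rewrite multiplicative_funM => /eqP; rewrite mulf_eq0 => /orP[] /eqP m0.
  by rewrite hF; [rewrite m0 (IH m0) !mul0r addr0|left].
rewrite hF; last by right.
by rewrite m0 (Fsq _ (msq _ m0)) !mulr0 addr0.
Qed.

Lemma sine_law_Psi (F : S -> R[i]) :
    (forall x y, F (x * y)%g = F x * m y + m x * F y) ->
  exists A : additive_fun R (null_complement m), F =1 Psi A.
Proof.
move=> hF.
have AM (u v : null_complement m) :
    F (u * v)%g / m (u * v)%g = F u / m u + F v / m v.
  rewrite [(val (u * v)%g : S)](_ : _ = (val u * val v)%g) //= hF.
  rewrite multiplicative_funM.
  have u0 := null_complement_neq0 u; have v0 := null_complement_neq0 v.
  by field; rewrite u0 v0.
exists (AdditiveFun AM); apply: eq_Psi => [|u /=].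
  by apply: sine_law_null => x y _.
by rewrite mulrC divfK ?null_complement_neq0.
Qed.
(** Off the null ideal, [h / m] is additive up to [l * A u * A v], which is half the cross term of
    [l * A (u * v) ^+ 2]. Hence [2 * h / m - l * A ^+ 2] is additive. *)
Lemma quadratic_sine_law_Psi (l : R[i]) (A : additive_fun R (null_complement m))
    (h : S -> R[i]) :
    (forall x y,
      h (x * y)%g = h x * m y + m x * h y + l * (Psi A x * Psi A y)) ->
  exists A1 : additive_fun R (null_complement m),
    h =1 (fun x => 1 / 2 * Psi (fun u => A1 u + l * A u ^+ 2) x).
Proof.
move=> hh; have h0 : forall x, m x = 0 -> h x = 0.
  apply: sine_law_null => x y mxy; rewrite hh.
  by case: mxy => mxy; rewrite (Psi_null _ mxy) ?mul0r ?mulr0 addr0.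
have A1M (u v : null_complement m) :
    2 * h (u * v)%g / m (u * v)%g - l * A (u * v)%g ^+ 2 =
    (2 * h u / m u - l * A u ^+ 2) + (2 * h v / m v - l * A v ^+ 2).
  rewrite additive_funM [(val (u * v)%g : S)](_ : _ = (val u * val v)%g) //= hh.
  rewrite multiplicative_funM !Psi_val.
  have u0 := null_complement_neq0 u; have v0 := null_complement_neq0 v.
  by field; rewrite u0 v0.
exists (AdditiveFun A1M) => x.
rewrite -(@eq_Psi (fun x => 2 * h x)); first by field.
  by move=> z /h0 ->; rewrite mulr0.
by move=> u /=; have u0 := null_complement_neq0 u; field; rewrite u0.
Qed.
End Psi.

(** * Linear independence as a non-zero determinant *)

Section Independence.
Set Implicit Arguments.
Unset Strict Implicit.
Variable R : realType.

(** If all determinants with a fixed [z1] vanished, [- h z1] and [f z1] would be the coefficients of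
    a non-trivial relation. *)
Lemma linearly_independent2_det_neq0 (T : Type) (f h : T -> R[i]) :
    linearly_independent2 f h ->
  exists z1 z2, f z1 != 0 /\ f z1 * h z2 - f z2 * h z1 != 0.
Proof.
move=> fh; have [z1 fz1] : exists z1, f z1 != 0.
  apply: contrapT => nf; have [x|/eqP] := fh 1 0; last by rewrite oner_eq0.
  rewrite mul0r addr0 mul1r; apply: contrapT => /eqP fx.
  by apply: nf; exists x.
exists z1; apply: contrapT => nd; have [x|_ /eqP] := fh (- h z1) (f z1).
  apply: contrapT => /eqP e; apply: nd; exists x; split=> //.
  by rewrite (_ : _ - _ = - h z1 * f x + f z1 * h x) //; ring.
by rewrite (negbTE fz1).
Qed.
End Independence.

(** * Classification of the solutions by the structure constants [k] and [n] *)

Theorem theorem5p1 (R : realType) (S : semigroupType)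
    (hS : generated_by_squares S)
    (lambda2 : R[i]) (hlambda2 : lambda2 != 0)
    (f g1 h g2 : S -> R[i])
    (hf : forall x y : S, f (x * y)%g = f x * g1 y + g1 x * f y)
    (hh : forall x y : S,
      h (x * y)%g = h x * g2 y + g2 x * h y + lambda2 ^+ 2 * f x * f y)
    (hfh : linearly_independent2 f h) :
  (exists (m : multiplicative_fun R S)
          (A A1 : additive_fun R (null_complement m)),
    [/\ ~ (m =1 fun=> 0), ~ (A =1 fun=> 0) & forall x : S,
      [/\ f x = Psi A x,
          g1 x = m x,
          h x = 1 / 2 * Psi (fun u => A1 u + lambda2 ^+ 2 * A u ^+ 2) x
        & g2 x = m x]])
  \/
  (exists (m mu : multiplicative_fun R S)
          (A : additive_fun R (null_complement m)) (alpha : R[i]),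
    [/\ ~ (m =1 fun=> 0), ~ (m =1 mu), ~ (A =1 fun=> 0), alpha != 0
      & forall x : S,
      [/\ f x = alpha * (mu x - m x),
          g1 x = (mu x + m x) / 2,
          h x = alpha ^+ 2 * lambda2 ^+ 2 * (mu x - m x)
                - alpha * lambda2 * Psi A x
        & g2 x = m x]])
  \/
  (exists (m mu : multiplicative_fun R S)
          (A : additive_fun R (null_complement m)) (c : R[i]),
    [/\ ~ (m =1 fun=> 0), ~ (m =1 mu), ~ (A =1 fun=> 0), c != 0
      & forall x : S,
      [/\ f x = 1 / lambda2 * Psi A x,
          g1 x = m x,
          h x = c ^+ 2 * (mu x - m x) - c * Psi A x
        & g2 x = (mu x - m x) / 2 - 1 / (2 * c) * Psi A x]])
  \/
  (exists (m mu : multiplicative_fun R S)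
          (A : additive_fun R (null_complement m)) (c d : R[i]),
    [/\ ~ (m =1 fun=> 0), ~ (m =1 mu), ~ (A =1 fun=> 0), c != 0 /\ d != 0
      & forall x : S,
      [/\ f x = - (1 / (d * lambda2)) * (mu x - m x),
          g1 x = (mu x + m x) / 2,
          h x = c * (mu x - m x) + 1 / d * Psi A x
        & g2 x = m x]])
  \/
  (exists (m mu : multiplicative_fun R S)
          (A : additive_fun R (null_complement m)) (c d : R[i]),
    [/\ [/\ ~ (m =1 fun=> 0), ~ (m =1 mu) & ~ (A =1 fun=> 0)],
        c != 0, d != 0, 1 - c * d ^+ 2 = 0
      & forall x : S,
      [/\ f x = 1 / lambda2 * Psi A x,
          g1 x = m x,
          h x = c * (mu x - m x) + 1 / d * Psi A x
        & g2 x = (mu x + m x) / 2 - 1 / 2 * d * Psi A x]])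
  \/
  (exists (chi1 chi2 chi3 : multiplicative_fun R S) (beta lambda c : R[i]),
    [/\ [/\ ~ (chi1 =1 chi2), ~ (chi1 =1 chi3) & ~ (chi2 =1 chi3)],
        [/\ beta != 0, lambda != 0 & c != 0],
        2 * c * lambda ^+ 2 * beta * (2 - beta) = 1
      & forall x : S,
      [/\ f x = (chi1 x - chi2 x) / (2 * lambda * lambda2),
          g1 x = (chi1 x + chi2 x) / 2,
          h x = c * beta * chi1 x + c * (2 - beta) * chi2 x - 2 * c * chi3 x
        & g2 x = (beta * chi1 x + (2 - beta) * chi2 x + 2 * chi3 x) / 4]])
  \/
  (exists (chi1 chi2 chi3 : multiplicative_fun R S) (beta lambda c : R[i]),
    [/\ [/\ ~ (chi1 =1 chi2), ~ (chi1 =1 chi3) & ~ (chi2 =1 chi3)],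
        [/\ beta != 0, lambda != 0 & c != 0],
        2 * c * lambda ^+ 2 * beta * (2 - beta) = 1
      & forall x : S,
      [/\ f x = 1 / (lambda * lambda2 * (2 - beta)) * (chi1 x - chi3 x),
          g1 x = (chi1 x + chi3 x) / 2,
          h x = c * beta * chi1 x + c * (2 - beta) * chi2 x - 2 * c * chi3 x
        & g2 x = (- beta * chi1 x + (2 - beta) * chi2 x + 2 * chi3 x)
                 / (2 * (2 - beta))]])
  \/
  (exists (chi1 chi2 chi3 : multiplicative_fun R S) (beta lambda c : R[i]),
    [/\ [/\ ~ (chi1 =1 chi2), ~ (chi1 =1 chi3) & ~ (chi2 =1 chi3)],
        [/\ beta != 0, lambda != 0 & c != 0],
        2 * c * lambda ^+ 2 * beta * (2 - beta) = 1
      & forall x : S,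
      [/\ f x = - (1 / (lambda * lambda2 * beta)) * (chi2 x - chi3 x),
          g1 x = (chi2 x + chi3 x) / 2,
          h x = c * beta * chi1 x + c * (2 - beta) * chi2 x - 2 * c * chi3 x
        & g2 x = (beta * chi1 x - (2 - beta) * chi2 x + 2 * chi3 x)
                 / (2 * beta)]]).
Proof.
have [z1 [z2 [fz1 det0]]] := linearly_independent2_det_neq0 hfh.
pose l := lambda2 ^+ 2; have l0 : l != 0 by rewrite expf_neq0.
have hh' x y : h (x * y)%g = h x * g2 y + g2 x * h y + l * (f x * f y).
  by rewrite hh mulrA.
have [k [n [g2E g1M muM]]] := structure_constants hf hh' l0 fz1 det0.
have dep a : ~ (forall x, h x = a * f x).
  move=> ha; have [x|_ /eqP] := hfh (- a) 1; first by rewrite ha; ring.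
  by rewrite oner_eq0.
have f_neq0 a : a != 0 -> ~ (forall x, a * f x = 0).
  by move=> a0 /(_ z1)/eqP; rewrite mulf_eq0 (negbTE a0) (negbTE fz1).
have [k0|k0] := eqVneq k 0.
  have g2M x y : g2 (x * y)%g = g2 x * g2 y.
    by have := muM x y; rewrite k0 !mul0r !addr0.
  pose m := MultiplicativeFun g2M.
  have [n0|n0] := eqVneq n 0.
    have g12 x : g1 x = g2 x by rewrite g2E k0 n0 !mul0r !addr0.
    left; have [|A fA] := sine_law_Psi (m := m) hS (F := f).
      by move=> x y; rewrite hf !g12.
    have [|A1 hA1] := quadratic_sine_law_Psi hS (A := A) (h := h) (l := l).
      by move=> x y; rewrite hh' -!fA.
    have [|m0 A0] := @Psi_neq0 _ _ m A.
      move=> PA; apply: (f_neq0 1 (oner_neq0 _)) => x.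
      by rewrite fA PA mulr0.
    by exists m, A, A1.
  right; left.
  have g1E x : g1 x = g2 x - n * f x by rewrite g2E k0; ring.
  have muM' x y : g1 (x * y)%g - n * f (x * y)%g =
      (g1 x - n * f x) * (g1 y - n * f y).
    by rewrite g1M hf k0; ring.
  (* Here the coefficient in [g1M] is [n ^+ 2], so [g1 + n * f], which is [m], and [g1 - n * f] are
     both multiplicative; their difference yields [alpha = - 1 / (2 * n)]. *)
  pose mu := MultiplicativeFun
    (multiplicative_fun_val := fun x => g1 x - n * f x) muM'.
  have fE x : f x = - (1 / (2 * n)) * (mu x - m x).
    by rewrite /= g1E; field; rewrite n0.
  (* This combination is form (2) solved for [Psi A]. It obeys the sine law because the [f x * f y]
     terms, [2 * n * lambda2] from [h] and its opposite from [f], cancel. *)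
  have [|A hA] := sine_law_Psi (m := m) hS
      (F := fun x => 2 * n / lambda2 * h x + lambda2 * f x).
    by move=> x y /=; rewrite hh hf !g1E; field; rewrite hlambda2.
  have [|m0 A0] := @Psi_neq0 _ _ m A.
    move=> PA; apply: (dep (- l / (2 * n))) => x.
    apply: (mulfI (mulf_neq0 n0 (invr_neq0 hlambda2))).
    have := hA x; rewrite PA => /(canRL (addrK _)) e.
    transitivity ((2 * n / lambda2 * h x) / 2).
      by field; rewrite hlambda2.
    by rewrite e /l; field; rewrite hlambda2 n0.
  exists m, mu, A, (- (1 / (2 * n))); split=> //.
  - move=> mmu; apply: (f_neq0 1 (oner_neq0 _)) => x.
    by rewrite fE mmu subrr !mulr0.
  - by rewrite oppr_eq0 div1r invr_eq0 mulf_neq0 ?Num.Theory.pnatr_eq0.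
  move=> x; split=> //; first by rewrite /= g1E; field.
  by rewrite -hA /= g1E; field; rewrite hlambda2 n0.
right; right; right; right.
pose mu := MultiplicativeFun
  (multiplicative_fun_val := fun x => g2 x + k * h x) muM.
have hE x : h x = (mu x - g1 x - n * f x) / (2 * k).
  by rewrite /= g2E; field; rewrite k0.
have [b0|b0] := eqVneq (n ^+ 2 - 2 * k * l) 0.
  left.
  have g1M' x y : g1 (x * y)%g = g1 x * g1 y by rewrite g1M b0 mul0r addr0.
  have n2E : n ^+ 2 = 2 * k * l by apply/eqP; rewrite -subr_eq0 b0.
  have n0 : n != 0.
    apply: contra_eq_neq n2E => ->; rewrite expr0n eq_sym.
    by rewrite !mulf_neq0 ?Num.Theory.pnatr_eq0.
  pose m := MultiplicativeFun g1M'.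
  have [|A fA] := sine_law_Psi (m := m) hS (F := fun x => lambda2 * f x).
    by move=> x y /=; rewrite hf; ring.
  have [|m0 A0] := @Psi_neq0 _ _ m A.
    by move=> PA; apply: (f_neq0 _ hlambda2) => x; rewrite fA PA.
  have lE : lambda2 ^+ 2 = n ^+ 2 / (2 * k).
    by rewrite n2E /l; field; rewrite k0.
  (* [c] is the coefficient of [mu] in [hE], and [d] comes from [2 * g2 = mu + g1 + n * f]; the
     relation [1 - c * d ^+ 2 = 0] is then [n2E]. *)
  exists m, mu, A, (1 / (2 * k)), (- (n / lambda2)); split=> //.
  - split=> // mmu; apply: (dep (- n / (2 * k))) => x.
    by rewrite {1}hE -mmu /=; field; rewrite k0.
  - by rewrite div1r invr_eq0 mulf_neq0 ?Num.Theory.pnatr_eq0.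
  - by rewrite oppr_eq0 mulf_neq0 ?invr_eq0.
  - by rewrite sqrrN expr_div_n lE; field; rewrite k0 n0.
  move=> x; rewrite -fA; split=> //.
  + by field; rewrite hlambda2.
  + rewrite {1}hE /=.
    rewrite (_ : 1 / - (n / lambda2) * (lambda2 * f x) =
      - (lambda2 ^+ 2 * f x / n)); last by field; rewrite hlambda2 n0.
    by rewrite lE; field; rewrite k0 n0.
  + by rewrite /= !g2E; field; rewrite hlambda2.
right; left.
pose s := Num.Theory.sqrtC (n ^+ 2 - 2 * k * l).
have s2 : s ^+ 2 = n ^+ 2 - 2 * k * l by rewrite /s Num.Theory.sqrtCK.
have s0 : s != 0 by move: b0; rewrite -s2 expf_eq0.
have chiM t : t ^+ 2 = s ^+ 2 -> forall x y,
    g1 (x * y)%g + t * f (x * y)%g = (g1 x + t * f x) * (g1 y + t * f y).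
  by move=> ts x y; rewrite g1M hf -s2 -ts; ring.
pose chi1 := MultiplicativeFun (chiM s erefl).
pose chi2 := MultiplicativeFun (chiM (- s) (sqrrN s)).
have lE : lambda2 ^+ 2 = (n ^+ 2 - s ^+ 2) / (2 * k).
  by rewrite s2 /l; field; rewrite k0.
have nsE : (s + n) * (s - n) = - (2 * k * lambda2 ^+ 2).
  by rewrite lE; field; rewrite k0.
(* With [t = s] and [t = - s] this separates [mu] from [chi1] and [chi2]: an equality would make [h]
   a multiple of [f]. *)
have eq_mu t : (fun x => g1 x + t * f x) =1 mu -> False.
  move=> tmu; apply: (dep ((t - n) / (2 * k))) => x.
  by rewrite {1}hE -tmu /=; field; rewrite k0.
have eqE : 2 * - (1 / (4 * k)) * (s / lambda2) ^+ 2 * (1 + n / s)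
    * (2 - (1 + n / s)) = 1.
  transitivity (- ((s + n) * (s - n)) / (2 * k * lambda2 ^+ 2)).
    by field; rewrite hlambda2 k0 s0.
  by rewrite nsE; field; rewrite hlambda2 k0.
(* [lambda] comes from [chi1 - chi2 = 2 * s * f]. Since [g1 + n * f] is half of
   [(1 + n / s) * chi1 + (1 - n / s) * chi2], [hE] gives [beta] and [c]. *)
exists chi1, chi2, mu, (1 + n / s), (s / lambda2), (- (1 / (4 * k))).
split=> //.
- split; [move=> chi12 | exact: eq_mu | exact: eq_mu].
  apply: (f_neq0 (2 * s)) => [|x].
    by rewrite mulf_neq0 ?Num.Theory.pnatr_eq0.
  transitivity (chi1 x - chi2 x); first by rewrite /=; ring.
  by rewrite chi12 subrr.
- split.
  + apply/eqP => e; move/eqP: eqE.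
    by rewrite e mulr0 mul0r eq_sym oner_eq0.
  + by rewrite mulf_neq0 ?invr_eq0.
  + by rewrite oppr_eq0 div1r invr_eq0 mulf_neq0 ?Num.Theory.pnatr_eq0.
move=> x; split.
- by rewrite /=; field; rewrite hlambda2 s0.
- by rewrite /=; field.
- by rewrite {1}hE /=; field; rewrite k0 s0.
- by rewrite /= !g2E; field; rewrite s0.
Qed.
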